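(* The edge variant of subgraph reconfiguration under the TJ rule can be solved in linear time for the property ''a graph is a tree.''
   Context: Graphs are finite, simple and undirected. In the edge variant for property $\Pi$ on a graph $G$, a feasible solution is an edge subset $E'\subseteq E(G)$ such that the graph formed by $E'$ (edge set $E'$ together with all endpoints of its edges) satisfies $\Pi$. Under the token jumping (TJ) rule, two feasible solutions $X,Y$ are adjacent if $|X\setminus Y|=|Y\setminus X|=1$. A reconfiguration sequence is a sequence of feasible solutions in which consecutive ones are adjacent. The problem: given $G$ and feasible source and target solutions $E_s,E_t$, decide whether a reconfiguration sequence from $E_s$ to $E_t$ exists. *)

(* Defs.v *)
From mathcomp Require Import all_boot.
Set Implicit Arguments. Unset Strict Implicit. Unset Printing Implicit Defensive.

(** * Graphs, with edges as two-element sets of vertices *)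

Record graph (V : finType) := Graph {
  vertices : {set V};
  edges : {set {set V}}
}.

Definition simple (V : finType) (G : graph V) : Prop :=
  {in edges G, forall e : {set V}, #|e| = 2 /\ e \subset vertices G}.

Definition adjacent (V : finType) (G : graph V) : rel V :=
  fun x y => [set x; y] \in edges G.

(* As usual, a connected graph has at least one vertex. *)
Definition connected (V : finType) (G : graph V) : Prop :=
  vertices G != set0 /\ {in vertices G &, forall x y : V, connect (adjacent G) x y}.

Definition acyclic (V : finType) (G : graph V) : Prop :=
  forall c : seq V, 2 < size c -> ~ ucycle (adjacent G) c.

Definition is_tree (V : finType) (G : graph V) : Prop :=
  connected G /\ acyclic G.

(** * Edge variant of subgraph reconfiguration under token jumping *)

Definition graph_property := forall V : finType, graph V -> Prop.

Definition graph_formed_by (V : finType) (F : {set {set V}}) : graph V :=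
  Graph (cover F) F.

Definition feasible (Pi : graph_property) (V : finType) (G : graph V)
    (F : {set {set V}}) : Prop :=
  F \subset edges G /\ Pi V (graph_formed_by F).

Definition tj_adjacent (V : finType) : rel {set {set V}} :=
  fun X Y => (#|X :\: Y| == 1) && (#|Y :\: X| == 1).

Definition tj_reconfigurable (Pi : graph_property) (V : finType) (G : graph V)
    (Es Et : {set {set V}}) : Prop :=
  exists s : seq {set {set V}},
    [/\ path (@tj_adjacent V) Es s,
        last Es s = Et
      & {in Es :: s, forall F : {set {set V}}, feasible Pi G F}].

(** * Random access machine
    Programs are structured (sequence, conditional, loop) over registers and a
    memory addressed through registers; every elementary instruction and every
    test costs one time unit. *)

Definition reg := nat.

Inductive prog : Type :=
| Skip
| Const of reg & nat           (* r := k *)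
| Add of reg & reg & reg       (* r := x + y *)
| Sub of reg & reg & reg       (* r := x - y, truncated at 0 *)
| LoadMem of reg & reg         (* r := mem[x] *)
| StoreMem of reg & reg        (* mem[x] := y *)
| Seq of prog & prog
| If of reg & prog & prog      (* the first branch is taken when r <> 0 *)
| While of reg & prog.         (* loops as long as r <> 0 *)

Record state := State { regs : reg -> nat; mem : nat -> nat }.

Definition upd (f : nat -> nat) (i v : nat) : nat -> nat :=
  fun j => if j == i then v else f j.

Definition set_reg (s : state) (r : reg) (v : nat) : state :=
  State (upd (regs s) r v) (mem s).

Definition set_mem (s : state) (a v : nat) : state :=
  State (regs s) (upd (mem s) a v).

(* [exec W p s t s']: from state [s], program [p] halts in state [s'] after
   exactly [t] time units.  [W] is the largest machine word: an instruction
   that would produce a larger number blocks, so unit cost is only charged for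
   arithmetic on words. *)
Inductive exec (W : nat) : prog -> state -> nat -> state -> Prop :=
| exec_skip s : exec W Skip s 1 s
| exec_const s r k : k <= W -> exec W (Const r k) s 1 (set_reg s r k)
| exec_add s r x y : regs s x + regs s y <= W ->
    exec W (Add r x y) s 1 (set_reg s r (regs s x + regs s y))
| exec_sub s r x y :
    exec W (Sub r x y) s 1 (set_reg s r (regs s x - regs s y))
| exec_load s r x : exec W (LoadMem r x) s 1 (set_reg s r (mem s (regs s x)))
| exec_store s x y : exec W (StoreMem x y) s 1 (set_mem s (regs s x) (regs s y))
| exec_seq p q s1 s2 s3 t u :
    exec W p s1 t s2 -> exec W q s2 u s3 -> exec W (Seq p q) s1 (t + u) s3
| exec_if_true r p q s s' t :
    regs s r != 0 -> exec W p s t s' -> exec W (If r p q) s t.+1 s'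
| exec_if_false r p q s s' t :
    regs s r == 0 -> exec W q s t s' -> exec W (If r p q) s t.+1 s'
| exec_while_stop r p s :
    regs s r == 0 -> exec W (While r p) s 1 s
| exec_while_step r p s1 s2 s3 t u :
    regs s1 r != 0 -> exec W p s1 t s2 -> exec W (While r p) s2 u s3 ->
    exec W (While r p) s1 (t + u).+1 s3.

Lemma exec_deterministic W p s t1 s1 :
  exec W p s t1 s1 -> forall t2 s2, exec W p s t2 s2 -> t1 = t2 /\ s1 = s2.
Proof.
elim=> {p s t1 s1}
  [s|s r k ?|s r x y ?|s r x y|s r x|s x y
  |p q s1 s2 s3 t u _ IHp _ IHq|r p q s s' t r_s _ IHp|r p q s s' t r_s _ IHp
  |r p s r_s|r p s1 s2 s3 t u r_s _ IHp _ IHq] t' s'' run;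
  inversion run; subst=> //;
  repeat match goal with
  | H : is_true (?x != 0), H' : is_true (?x == 0) |- _ => by rewrite H' in H
  | H : exec _ _ _ _ _ |- _ =>
      first [case/IHp: H => ? ? | case/IHq: H => ? ?]; subst
  end; by [].
Qed.

Definition initial_state (input : seq nat) : state :=
  State (fun=> 0) (fun i => nth 0 input i).

Definition output (s : state) : nat := regs s 0.

(** * Input encoding *)

(* [s] lists every edge of [F] once, in any order and with its endpoints in
   any order. *)
Definition edge_list (V : finType) (F : {set {set V}}) (s : seq (V * V)) : Prop :=
  let es := [seq [set e.1; e.2] | e <- s] in uniq es /\ es =i F.

Definition endpoints n (s : seq ('I_n * 'I_n)) : seq nat :=
  flatten [seq [:: val e.1; val e.2] | e <- s].

Definition encoding n (gs ss ts : seq ('I_n * 'I_n)) : seq nat :=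
  [:: n; size gs; size ss; size ts] ++ endpoints gs ++ endpoints ss ++ endpoints ts.

(* The words have log2 (n + m + 1) + O(1) bits, where n and m are the numbers
   of vertices and edges of the input graph. *)
Definition edge_tj_solvable_in_linear_time (Pi : graph_property) : Prop :=
  exists (p : prog) (c : nat),
  forall (n : nat) (G : graph 'I_n) (Es Et : {set {set 'I_n}})
         (gs ss ts : seq ('I_n * 'I_n)),
    vertices G = [set: 'I_n] -> simple G ->
    feasible Pi G Es -> feasible Pi G Et ->
    edge_list (edges G) gs -> edge_list Es ss -> edge_list Et ts ->
    let bound := c * (n + #|edges G|).+1 in
    exists (t : nat) (s : state),
      [/\ exec bound p (initial_state (encoding gs ss ts)) t s,
          t <= bound,
          tj_reconfigurable Pi G Es Et -> output s = 1
        & ~ tj_reconfigurable Pi G Es Et -> output s = 0].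

(* Main.v *)
Require Import Defs.
From mathcomp Require Import all_boot.
From mathcomp Require Import zify.
Set Implicit Arguments. Unset Strict Implicit. Unset Printing Implicit Defensive.

(** Token jumping preserves the number k of edges, and for k > 1 consecutive
    trees share an edge, hence lie in the same component of G.  Conversely, two
    trees with k edges in the same component are reconfigurable: a tree is moved
    along a path of G by adding the next path edge and dropping a leaf; once
    both trees contain a common root, one exchanges edges as in the graphic
    matroid so that their common part at the root, which stays a subtree, grows.
    So the answer is yes iff the sizes agree and k = 1 or the first endpoints of
    the two edge lists are connected in G, which a depth-first search on linked
    adjacency lists decides in linear time. *)

(** * Forests as independent sets of the graphic matroid *)

Section EdgeSets.
Variable V : finType.
Implicit Types (x y v w : V) (e : {set V}) (F T : {set {set V}}).

(** A matroid exchange only preserves forests, while every token jump must also preserve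
    connectedness. Therefore [spans v] is carried along with [forest], and the dropped edge has to
    be chosen with care. One exchange lemma, [forest_swap], serves both phases. It never drops an
    edge of the protected part [F]: with [F] empty it moves the tree along a path, and with [F] the
    agreed part at the root it brings the tree closer to the target. A tree has a vertex, and the
    graph formed by an edge set has only covered vertices, so a feasible solution has at least one
    edge. Hence the program can always read a root from each edge list. Memory beyond the input is
    initially zero, so empty lists and cleared marks cost no initialization time. *)

Definition adj F : rel V := fun x y => [set x; y] \in F.

Definition linked F : rel V := connect (adj F).

(** Acyclicity in the form that every edge is a bridge, which suits exchange arguments better than
    cycles as sequences. *)
Definition forest F : Prop :=
  forall x y, x != y -> [set x; y] \in F -> ~~ linked (F :\ [set x; y]) x y.

(* [v] need not be covered by [F]: the empty set is spanned from every vertex. *)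
Definition spans v F : Prop :=
  forall x y, x != y -> [set x; y] \in F -> linked F v x.

Definition two_sets F : Prop := forall e, e \in F -> #|e| = 2.

Lemma linked_sym F : symmetric (linked F).
Proof. by apply: sym_connect_sym => x y; rewrite /adj setUC. Qed.

Lemma linked_trans F : transitive (linked F).
Proof. exact: connect_trans. Qed.

Lemma linked_refl F x : linked F x x.
Proof. exact: connect0. Qed.

Lemma linked1 F x y : [set x; y] \in F -> linked F x y.
Proof. by move=> xyF; apply: connect1. Qed.

Lemma linked_sub F F' : F \subset F' -> subrel (linked F) (linked F').
Proof.
move=> /subsetP sFF'; apply: connect_sub => x y xyF.
by apply: linked1; apply: sFF'.
Qed.

Lemma eq_pair x y a b : [set a; b] = [set x; y] ->
  (a = x /\ b = y) \/ (a = y /\ b = x).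
Proof.
move=> E.
have: a \in [set x; y] by rewrite -E set21.
have: b \in [set x; y] by rewrite -E set22.
have: x \in [set a; b] by rewrite E set21.
have: y \in [set a; b] by rewrite E set22.
rewrite !inE => /orP[] /eqP Ey /orP[] /eqP Ex /orP[] /eqP Eb /orP[] /eqP Ea.
all: by [left; split; congruence | right; split; congruence].
Qed.

Lemma linkedU1 F x y a b : linked ([set x; y] |: F) a b ->
  [\/ linked F a b, linked F a x /\ linked F y b
    | linked F a y /\ linked F x b].
Proof.
move=> /connectP[p]; elim: p a => [|c p IH] a /= => [_ ->|].
  by constructor 1; apply: linked_refl.
case/andP; rewrite {1}/adj in_setU1 => /orP[/eqP ac|acF] pp lp.
  case: (eq_pair ac) => -[? ?]; subst a c; case: (IH _ pp lp).
  - by move=> ?; constructor 2; split => //; apply: linked_refl.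
  - by case=> _ ?; constructor 2; split => //; apply: linked_refl.
  - by case=> _ ?; constructor 1.
  - by move=> ?; constructor 3; split => //; apply: linked_refl.
  - by case=> _ ?; constructor 1.
  - by case=> _ ?; constructor 3; split => //; apply: linked_refl.
have lac := linked1 acF.
case: (IH _ pp lp) => [cb|[cx yb]|[cy xb]].
- by constructor 1; apply: linked_trans cb.
- by constructor 2; split=> //; apply: linked_trans cx.
- by constructor 3; split=> //; apply: linked_trans cy.
Qed.

Lemma forest_sub F F' : F \subset F' -> forest F' -> forest F.
Proof.
move=> sFF' fF' x y xy xyF; apply: contra (fF' x y xy (subsetP sFF' _ xyF)).
by apply: linked_sub; apply: setSD.
Qed.

(** If an old edge [ab] stopped being a bridge, the detour would use the new edge; closing its two
    remaining pieces by [ab] would link [x] to [y] in [F]. *)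
Lemma forestU1 F x y : forest F -> ~~ linked F x y ->
  forest ([set x; y] |: F).
Proof.
move=> fF nxy a b ab; rewrite in_setU1.
have [abxy _|nab /= abF] := eqVneq [set a; b] [set x; y].
  have nl : ~~ linked F a b.
    by case: (eq_pair abxy) => -[-> ->] //; rewrite linked_sym.
  apply: contra nl; apply: linked_sub; rewrite abxy.
  by apply/subsetP => e; rewrite !inE; case: eqP.
apply/negP => lab.
have nl := fF a b ab abF.
have lF : subrel (linked (F :\ [set a; b])) (linked F).
  by apply: linked_sub; apply: subsetDl.
have : linked ([set x; y] |: (F :\ [set a; b])) a b.
  apply: linked_sub lab; apply/subsetP => e; rewrite !inE.
  by case/andP => -> /orP[->|->] //; rewrite orbT.
move/linkedU1 => [|[/lF ax /lF yb]|[/lF ay /lF xb]]; first by apply/negP.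
  move: nxy; rewrite linked_sym => /negP; apply.
  apply: linked_trans yb _.
  by apply: linked_trans ax; rewrite linked_sym; apply: linked1.
move/negP: nxy; apply; apply: linked_trans xb _.
by apply: linked_trans ay; rewrite linked_sym; apply: linked1.
Qed.

Lemma spans_grow v F T : two_sets T -> spans v F -> spans v T -> F \proper T ->
  exists x w, [/\ x != w, [set x; w] \in T :\: F & linked F v x].
Proof.
move=> T2 sF sT /properP[sFT [e eT eF]].
have /eqP/cards2P[x [y [xy E]]] := T2 _ eT; subst e.
have /connectP[p pp lp] := sT _ _ xy eT.
have [|nx] := boolP (linked F v x).
  by move=> vx; exists x, y; split=> //; rewrite inE eF.
have := linked_refl F v.
(* Follow the [T]-path while [F] still links [v] to the current vertex [a]. Reaching [x] this way
   contradicts [nx], so some step leaves [F], and the first such edge is the one wanted. *)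
move: pp lp; move: {1 2 4}v; elim: p => [|c p IH] a /=; first by move=> _ <- /(negP nx).
case/andP=> ac pp lp va.
have [acF|acF] := boolP ([set a; c] \in F).
  by apply: (IH c) => //; apply: linked_trans va (linked1 acF).
exists a, c; split=> //; last by rewrite inE acF.
have := T2 _ ac; rewrite cards2; by case: eqP.
Qed.

Lemma spansU1 v F x w : spans v F -> linked F v x ->
  spans v ([set x; w] |: F).
Proof.
move=> sF vx.
have sub : subrel (linked F) (linked ([set x; w] |: F)).
  by apply: linked_sub; apply: subsetUr.
have xw : linked ([set x; w] |: F) x w by apply: linked1; rewrite in_setU1 eqxx.
move=> a b ab; rewrite in_setU1 => /orP[/eqP/eq_pair[] [-> _]|abF].
- exact: sub.
- by apply: linked_trans xw; apply: sub.
- exact/sub/(sF _ _ ab).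
Qed.

(* The last edge in an edge-by-edge growth of [F] to [T] is a leaf of [T]. *)
Lemma spans_leaf v F T : two_sets T -> spans v F -> spans v T -> F \proper T ->
  exists2 e, e \in T :\: F & spans v (T :\ e).
Proof.
move=> T2 + sT; move Dk : #|T :\: F| => k.
elim: k F Dk => [|k IH] F Dk sF pFT.
  by move: Dk => /eqP; rewrite cards_eq0 setD_eq0 => sTF; move: pFT; rewrite properE sTF andbF.
have [x [w [xw xwTF vx]]] := spans_grow T2 sF sT pFT.
have sub : [set x; w] |: F \subset T.
  rewrite subUset sub1set (proper_sub pFT) andbT.
  by move: xwTF; rewrite inE => /andP[].
have sF' := spansU1 (w := w) sF vx.
have [E|nE] := eqVneq ([set x; w] |: F) T.
  exists [set x; w] => //.
  suff -> : T :\ [set x; w] = F by [].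
  rewrite -E setU1K //; by move: xwTF; rewrite inE => /andP[].
have Dk' : #|T :\: ([set x; w] |: F)| = k.
  move: Dk; rewrite (cardsD1 [set x; w]) xwTF add1n => -[<-].
  by rewrite setDDl setUC.
have [|e eT se] := IH _ Dk' sF'.
  by rewrite properEneq nE.
exists e => //; move: eT; rewrite !inE negb_or -andbA => /and3P[_ -> ->]//.
Qed.

(** Take a minimal [D] between [F] and [T] that links [x] to [w]. By minimality each edge of [D]
    outside [F] separates [x] from [w] in [D]; it does so in [T] too, since otherwise its ends would
    stay linked in [T] without it. *)
Lemma forest_cut F T x w : two_sets T -> forest T -> F \subset T ->
  linked T x w -> ~~ linked F x w ->
  exists a b, [/\ a != b, [set a; b] \in T :\: F,
    ~~ linked (T :\ [set a; b]) x w, linked (T :\ [set a; b]) x a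
    & linked (T :\ [set a; b]) b w].
Proof.
move=> T2 fT sFT lT nF.
pose P (D : {set {set V}}) := (F \subset D) && linked D x w.
have PT : P T by rewrite /P sFT.
have [D /minsetP[/andP[sFD lD] minD] sDT] := minset_exists PT.
have : ~~ (D \subset F).
  apply: contra nF => sDF; suff <- : D = F by [].
  by apply/eqP; rewrite eqEsubset sDF.
case/subsetPn => e eD eF.
have eT := subsetP sDT _ eD.
have /eqP/cards2P[a [b [ab E]]] := T2 _ eT; subst e.
have nl : ~~ linked (D :\ [set a; b]) x w.
  apply/negP => l.
  have : [set a; b] \notin D.
    rewrite -(minD (D :\ [set a; b])) ?subsetDl ?inE ?eqxx //.
    rewrite /P l andbT; apply/subsetP => e eF'; rewrite !inE (subsetP sFD) // andbT.
    by apply: contraNneq eF => <-.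
  by rewrite eD.
have sub : subrel (linked (D :\ [set a; b])) (linked (T :\ [set a; b])).
  by apply: linked_sub; apply: setSD.
have key c d : [set c; d] = [set a; b] -> c != d ->
   linked (D :\ [set a; b]) x c -> linked (D :\ [set a; b]) d w ->
  exists a b, [/\ a != b, [set a; b] \in T :\: F,
    ~~ linked (T :\ [set a; b]) x w, linked (T :\ [set a; b]) x a
    & linked (T :\ [set a; b]) b w].
  move=> cdE cd /sub xc /sub dw; exists c, d; rewrite cdE; split=> //.
    by rewrite inE eF.
  have := fT _ _ cd; rewrite cdE => /(_ eT); apply: contra => xw.
  apply: linked_trans (_ : linked _ c x) _; first by rewrite linked_sym.
  by apply: linked_trans xw _; rewrite linked_sym.
move: lD; rewrite -{1}(setD1K eD) => /linkedU1[|[xa bw]|[xb aw]].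
- by move/(negP nl).
- exact: (key a b).
- by apply: (key b a) => //; [rewrite setUC | rewrite eq_sym].
Qed.

Definition swap e e' T := e' |: (T :\ e).

Lemma swap_adjacent e e' T : e \in T -> e' \notin T -> tj_adjacent T (swap e e' T).
Proof.
move=> eT e'T.
have ne : e != e' by apply: contraNneq e'T => <-.
rewrite /tj_adjacent /swap.
have -> : T :\: (e' |: T :\ e) = [set e].
  apply/setP => z; rewrite !inE; have [->|ze] := eqVneq z e.
    by rewrite eT andbT (negbTE ne).
  by case: (z \in T); rewrite ?andbF // orbT.
have -> : (e' |: T :\ e) :\: T = [set e'].
  apply/setP => z; rewrite !inE; have [->|ze] := eqVneq z e'.
    by rewrite e'T.
  by case: (z \in T); rewrite ?andbF.
by rewrite !cards1.
Qed.

Lemma card_swap e e' T : e \in T -> e' \notin T -> #|swap e e' T| = #|T|.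
Proof. by move=> eT e'T; rewrite cardsU1 (cardsD1 e T) eT !inE (negbTE e'T) andbF. Qed.

(* [F] is the part of [T] that already agrees with the target tree; [e] is an
   edge outside [F] on the path of [T] from [x] to [w] or, without such a path,
   a leaf edge of [T]. *)
Lemma forest_swap v F T x w : two_sets T -> forest T -> spans v T ->
    spans v F -> F \proper T -> linked F v x -> ~~ linked F x w ->
  exists2 e, e \in T :\: F &
    forest (swap e [set x; w] T) /\ spans v (swap e [set x; w] T).
Proof.
move=> T2 fT sT sF pFT vx nF; have sFT := proper_sub pFT.
have vxT := linked_sub sFT vx.
have fD e : forest (T :\ e) by apply: forest_sub fT; apply: subsetDl.
have [lT|nT] := boolP (linked T x w); last first.
  have [e eTF se] := spans_leaf T2 sF sT pFT.
  have [eT eF] : e \in T /\ e \notin F by move: eTF; rewrite inE => /andP[].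
  exists e => //; split.
    apply: forestU1 => //; apply: contra nT.
    by apply: linked_sub; apply: subsetDl.
  apply: spansU1 => //; apply: linked_sub vx.
  by apply/subsetD1P.
have [a [b [ab abTF nxw xa bw]]] := forest_cut T2 fT sFT lT nF.
exists [set a; b] => //; split; first exact: forestU1.
set T1 := swap _ _ _.
have sub : subrel (linked (T :\ [set a; b])) (linked T1).
  by apply: linked_sub; apply: subsetUr.
have xw1 : linked T1 x w by apply: linked1; rewrite in_setU1 eqxx.
(* The lost edge is bypassed by going from [a] to [x], over the new edge to [w], and on to [b]. *)
have ab1 : linked T1 a b.
  apply: linked_trans (_ : linked _ a x) _; first by rewrite linked_sym sub.
  by apply: linked_trans xw1 _; rewrite linked_sym sub.
have sub1 : subrel (linked T) (linked T1).
  apply: connect_sub => c d cd.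
  have [E|ne] := eqVneq [set c; d] [set a; b].
    by case: (eq_pair E) => -[-> ->] //; rewrite [connect _ _ _]linked_sym.
  by apply: sub; apply: linked1; rewrite !inE ne.
move=> c d cd; rewrite in_setU1 => /orP[/eqP/eq_pair[] [-> _]|].
- exact: sub1.
- by apply: linked_trans xw1; apply: sub1.
- by rewrite inE => /andP[_ cdT]; apply/sub1/(sT _ _ cd).
Qed.

End EdgeSets.

(** * Reconfiguration of subtrees *)

Section Trees.
Variable V : finType.
Implicit Types (x y v w : V) (e : {set V}) (F T : {set {set V}}).

Lemma cover_edge F x : two_sets F -> x \in cover F ->
  exists2 y, x != y & [set x; y] \in F.
Proof.
move=> F2 /bigcupP[e eF xe]; have /eqP/cards2P[a [b [ab E]]] := F2 _ eF.
move: xe eF; rewrite E !inE => /orP[] /eqP ->.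
  by exists b.
by rewrite setUC; exists a => //; rewrite eq_sym.
Qed.

(** The rest of the cycle leads from [y] through [z] back to [x]. From [z] on it avoids [y], hence
    avoids the edge [xy], which is therefore no bridge. *)
Lemma forest_acyclic F : forest F -> acyclic (graph_formed_by F).
Proof.
move=> fF [|x [|y [|z c]]] //= _ /andP[/= /andP[xyF]].
move=> /andP[yz pc] /and3P[]; rewrite !inE !negb_or => /and3P[xy xz xc] /andP[yz' yc] /andP[zc uc].
have /negP := fF _ _ xy xyF; apply.
rewrite linked_sym; apply: linked_trans (_ : linked _ y z) _.
  apply: linked1; rewrite in_setD1 [_ \in F]yz andbT.
  by apply/eqP => /eq_pair[] [? ?]; subst; rewrite eqxx in xy xz.
suff H p u : path (adj F) u p -> y \notin u :: p ->
    linked (F :\ [set x; y]) u (last u p).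
  rewrite -{2}(last_rcons z c x); apply: H => //.
  by rewrite inE mem_rcons inE !negb_or yz' eq_sym xy.
elim: p u {yz xz yz' zc pc} => [|d p IH] {}z /=; first by move=> *; apply: linked_refl.
case/andP=> zd pp; rewrite !inE !negb_or => /and3P[yz yd yp].
apply: linked_trans (_ : linked _ z d) _; last by apply: IH; rewrite // inE negb_or yd.
apply: linked1; rewrite in_setD1 [_ \in F]zd andbT.
by apply/eqP => /eq_pair[] [? ?]; subst; rewrite eqxx in yz yd.
Qed.

(** A simple path from [x] to [y] that avoids the edge [xy] has an inner vertex, so closing it by
    that edge gives a cycle of length at least 3. *)
Lemma acyclic_forest F : acyclic (graph_formed_by F) -> forest F.
Proof.
move=> aF x y xy xyF; apply/negP => /connectP[p pp lp].
move: lp xyF; case: (shortenP pp) => p' pp' up' _ lp xyF.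
have sub : subrel (adj (F :\ [set x; y])) (adj F).
  by move=> a b; rewrite /adj inE => /andP[].
case: p' pp' up' lp => [|z [|u p']] pp' up' lp.
- by move: xy; rewrite lp eqxx.
- by move: pp'; rewrite /= lp /adj !inE eqxx.
- apply: (aF (x :: z :: u :: p')) => //; apply/andP; split=> //.
  by rewrite /cycle rcons_path [path _ _ _](sub_path sub pp') -lp /adjacent setUC.
Qed.

Lemma tree_spans F v : is_tree (graph_formed_by F) -> v \in cover F -> spans v F.
Proof.
move=> [[_ cF] _] vF x y _ xyF; apply: cF => //.
by apply/bigcupP; exists [set x; y] => //; apply: set21.
Qed.

Lemma spans_tree F v : two_sets F -> F != set0 -> forest F -> spans v F ->
  is_tree (graph_formed_by F).
Proof.
move=> F2 /set0Pn[e eF] fF sF; split; last exact: forest_acyclic.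
have lv x : x \in cover F -> linked F v x.
  by move=> /(cover_edge F2)[y xy xyF]; apply: sF xyF.
split.
  have /eqP/cards2P[a [b [ab E]]] := F2 _ eF.
  by apply/set0Pn; exists a; apply/bigcupP; exists e => //; rewrite E set21.
by move=> x y /lv vx /lv vy; apply: linked_trans vy; rewrite -/(linked F x v) linked_sym.
Qed.

Lemma spans_move F v u : linked F v u -> spans v F -> spans u F.
Proof.
move=> vu sF x y xy xyF; apply: linked_trans (sF _ _ xy xyF).
by rewrite linked_sym.
Qed.

End Trees.

(** * Reconfiguration sequences of trees inside a host graph *)

Section Reconfiguration.
Variables (V : finType) (G : graph V).
Hypothesis sG : simple G.
Implicit Types (x y v w : V) (e : {set V}) (F T : {set {set V}}).

Notation reach := (tj_reconfigurable is_tree G).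
Notation ok := (feasible is_tree G).

Lemma two_sets_sub F : F \subset edges G -> two_sets F.
Proof. by move=> sF e /(subsetP sF)/sG[]. Qed.

Lemma feasible_forest F : ok F -> forest F.
Proof. by case=> _ [_ /acyclic_forest]. Qed.

Lemma feasible_neq0 F : ok F -> F != set0.
Proof.
case=> _ [[/set0Pn[x /bigcupP[e eF _]] _] _].
by apply/set0Pn; exists e.
Qed.

Lemma reach_refl F : ok F -> reach F F.
Proof. by move=> okF; exists [::]; split=> // F'; rewrite inE => /eqP->. Qed.

Lemma reach_step F F' T : ok F -> tj_adjacent F F' -> reach F' T -> reach F T.
Proof.
move=> okF aF [s [ps ls okS]]; exists (F' :: s); split=> //=; first by rewrite aF.
by move=> D; rewrite inE => /orP[/eqP->|/okS].
Qed.

Lemma reach_card F T : reach F T -> #|F| = #|T|.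
Proof.
case=> s [ps <- _]; elim: s F ps => [|F' s IH] F //= /andP[/andP[/eqP a /eqP b] ps].
rewrite -(IH _ ps) -(cardsID F' F) -(cardsID F F') setIC.
by rewrite a b.
Qed.

Lemma reach_linked F T x y : 1 < #|F| -> reach F T ->
  x \in cover F -> y \in cover T -> linked (edges G) x y.
Proof.
move=> + [s [ps lT okS]] xF yT; rewrite -{}lT in yT.
elim: s F x xF ps okS yT => [|F' s IH] F x xF /=.
  move=> _ okS yF _; have [sF [[_ cF] _]] := okS F (mem_head _ _).
  by apply: (linked_sub sF); apply: cF.
case/andP=> aF ps okS yT F1.
have okF : ok F by apply: okS; rewrite mem_head.
have okF' : ok F' by apply: okS; rewrite inE mem_head orbT.
have cF : #|F| = #|F'|.
  apply: reach_card; exists [:: F']; split=> //=; first by rewrite aF.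
  by move=> D; rewrite !inE => /orP[] /eqP->.
have [e] : exists e, e \in F :&: F'.
  apply/set0Pn; rewrite -card_gt0.
  by move: F1; rewrite -(cardsID F' F); case/andP: aF => /eqP-> _; rewrite addn1.
rewrite inE => /andP[eF eF'].
have /eqP/cards2P[a [b [ab E]]] := two_sets_sub (proj1 okF) eF.
have ain (D : {set {set V}}) : e \in D -> a \in cover D.
  by move=> eD; apply/bigcupP; exists e => //; rewrite E set21.
apply: linked_trans (_ : linked (edges G) x a) _.
  have [sF [[_ cF'] _]] := okF.
  by apply: (linked_sub sF); apply: cF' => //; apply: ain.
apply: (IH F') => //; last by rewrite -cF.
- exact: ain.
- by move=> D Ds; apply: okS; rewrite inE Ds orbT.
Qed.

Lemma feasible_swap v T e e' : T \subset edges G -> e \in T -> e' \in edges G -> e' \notin T ->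
  forest (swap e e' T) -> spans v (swap e e' T) -> ok (swap e e' T).
Proof.
move=> sT eT e'G e'T fS sS.
have sub : swap e e' T \subset edges G.
  by rewrite subUset sub1set e'G /= (subset_trans (subsetDl _ _) sT).
split=> //; apply: (spans_tree (v := v)) => //; first exact: two_sets_sub.
by rewrite -card_gt0 card_swap // (cardsD1 e) eT.
Qed.

(** Induction on the part of [T'] outside [F]. The next edge of [T'] at [F] either lies in [T]
    already, so that [F] grows without a jump, or is swapped in for an edge outside [F]. *)
Lemma rooted_reach v F T T' : ok T -> ok T' -> spans v T -> spans v T' ->
  #|T| = #|T'| -> F \subset T -> F \subset T' -> spans v F -> reach T T'.
Proof.
move=> + okT' + sT'; move Dk : #|T' :\: F| => k.
elim: k F T Dk => [|k IH] F T Dk okT sT cT FT FT' sF.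
  have E : F = T'.
    by apply/eqP; rewrite eqEsubset FT' -setD_eq0 -cards_eq0 Dk eqxx.
  suff -> : T = T' by apply: reach_refl.
  by apply/eqP; rewrite eq_sym eqEcard -{1}E FT cT leqnn.
have T2 := two_sets_sub (proj1 okT); have T2' := two_sets_sub (proj1 okT').
have pF' : F \proper T'.
  rewrite properEcard FT' /=; move: Dk; rewrite cardsD (setIidPr FT') => Dk.
  by rewrite -subn_gt0 Dk.
have [x [w [xw + vx]]] := spans_grow T2' sF sT' pF'.
rewrite inE => /andP[xwF xwT'].
have Dk' : #|T' :\: ([set x; w] |: F)| = k.
  move: Dk; rewrite (cardsD1 [set x; w]) !inE xwF xwT' add1n => -[<-].
  by rewrite setDDl setUC.
have FT1' : [set x; w] |: F \subset T' by rewrite subUset sub1set xwT'.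
have sF1 := spansU1 (w := w) sF vx.
have [xwT|xwT] := boolP ([set x; w] \in T).
  by apply: (IH _ _ Dk') => //; rewrite subUset sub1set xwT.
(* [F] lies in [T'] without the edge [xw], which is a bridge of the forest [T']. *)
have nl : ~~ linked F x w.
  apply: contra (feasible_forest okT' xw xwT'); apply: linked_sub.
  by apply/subsetD1P.
have pF : F \proper T.
  rewrite properEcard FT cT; by case/properP: (pF') => _ _; apply: proper_card.
have [e] := forest_swap T2 (feasible_forest okT) sT sF pF vx nl.
rewrite inE => /andP[eF eT] [fS sS].
have okS : ok (swap e [set x; w] T).
  apply: feasible_swap fS sS => //; first exact: (proj1 okT).
  exact: (subsetP (proj1 okT')).
apply: reach_step okT (swap_adjacent eT xwT) _.
apply: (IH _ _ Dk') => //; first by rewrite card_swap.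
by apply: setUS; apply/subsetD1P.
Qed.

Lemma connected_reach v T v' T' : ok T -> ok T' -> spans v T -> spans v' T' ->
  #|T| = #|T'| -> linked (edges G) v v' -> reach T T'.
Proof.
move=> okT okT' sT sT' cT /connectP[p].
elim: p v T okT sT cT => [|u p IH] v T okT sT cT /=.
  move=> _ E; subst v'; apply: (rooted_reach (v := v) (F := set0)); rewrite ?sub0set //.
  by move=> x y _; rewrite inE.
case/andP=> vuG pp lp.
have [vu|vu] := boolP (linked T v u).
  exact: (IH u T okT (spans_move vu sT)).
have vuT : [set v; u] \notin T by apply: contra vu; apply: linked1.
have s0 : spans v (set0 : {set {set V}}) by move=> x y _; rewrite inE.
have T2 := two_sets_sub (proj1 okT).
(* With the empty protected part, [u] being outside the tree, the new edge [vu] is attached at the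
   root and the root then moves to [u]. *)
have [||e eT [fS sS]] := forest_swap T2 (feasible_forest okT) sT s0 _
  (linked_refl _ _) (_ : ~~ linked set0 v u).
- by rewrite properEneq sub0set eq_sym feasible_neq0.
- by apply: contra vu; apply: linked_sub; apply: sub0set.
move: eT; rewrite inE => /andP[_ eT].
have okS := feasible_swap (proj1 okT) eT vuG vuT fS sS.
apply: reach_step okT (swap_adjacent eT vuT) _.
apply: (IH u _ okS) => //; last by rewrite card_swap.
by apply: spans_move sS; apply: linked1; rewrite in_setU1 eqxx.
Qed.

Lemma tree_tj_reconfigurable T T' x y : ok T -> ok T' -> x \in cover T -> y \in cover T' ->
  reach T T' <-> #|T| = #|T'| /\ (#|T| = 1 \/ linked (edges G) x y).
Proof.
move=> okT okT' xT yT'; split.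
  move=> r; split; first exact: reach_card.
  have [T1|] := leqP #|T| 1; last by move=> T1; right; apply: reach_linked T1 r xT yT'.
  left; apply/eqP; rewrite eqn_leq T1 card_gt0; exact: feasible_neq0.
case=> cT [T1|l]; last first.
  by apply: connected_reach (tree_spans (proj2 okT) xT) (tree_spans (proj2 okT') yT') cT l.
have [->|ne] := eqVneq T T'; first exact: reach_refl.
(* Two distinct single edges are one jump apart, wherever they lie in [G]. *)
apply: reach_step (okT) _ (reach_refl okT').
move: cT ne; rewrite T1 => /esym/eqP/cards1P[b ->]; move/eqP/cards1P: T1 => [a ->] ne.
have ab : a != b by apply: contraNneq ne => ->.
suff H c d : c != d -> [set c] :\: [set d] = [set c] :> {set {set V}}.
  by rewrite /tj_adjacent !H ?cards1 // eq_sym.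
move=> cd; apply/setP => z; rewrite !inE andbC.
by case: (eqVneq z c) => // ->; rewrite cd.
Qed.

End Reconfiguration.

(** * Running times of programs *)

Definition runs W p s T (Q : state -> Prop) : Prop :=
  exists t s', [/\ exec W p s t s', t <= T & Q s'].

(* Meaningful for loop-free programs only: a loop has cost 0 and [wp] False. *)
Fixpoint cost p : nat :=
  match p with
  | Seq p q => cost p + cost q
  | If _ p q => (maxn (cost p) (cost q)).+1
  | While _ _ => 0
  | _ => 1
  end.

Fixpoint wp W p (Q : state -> Prop) (s : state) : Prop :=
  match p with
  | Skip => Q s
  | Const r k => k <= W /\ Q (set_reg s r k)
  | Add r x y => regs s x + regs s y <= W /\ Q (set_reg s r (regs s x + regs s y))
  | Defs.Sub r x y => Q (set_reg s r (regs s x - regs s y))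
  | LoadMem r x => Q (set_reg s r (Defs.mem s (regs s x)))
  | StoreMem x y => Q (set_mem s (regs s x) (regs s y))
  | Seq p q => wp W p (wp W q Q) s
  | If r p q => (regs s r != 0 -> wp W p Q s) /\ (regs s r == 0 -> wp W q Q s)
  | While _ _ => False
  end.

Lemma wp_runs W p Q s : wp W p Q s -> runs W p s (cost p) Q.
Proof.
elim: p Q s => [|r k|r x y|r x y|r x|x y|p IHp q IHq|r p IHp q IHq|r p _] Q s //=.
- by move=> Qs; exists 1, s; split=> //; constructor.
- by case=> kW Qs; exists 1, (set_reg s r k); split=> //; constructor.
- by case=> xyW Qs; do 2 eexists; split; [constructor| |exact: Qs].
- by move=> Qs; do 2 eexists; split; [constructor| |exact: Qs].
- by move=> Qs; do 2 eexists; split; [constructor| |exact: Qs].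
- by move=> Qs; do 2 eexists; split; [constructor| |exact: Qs].
- move=> /IHp[t [s1 [e1 tp /IHq[u [s2 [e2 uq Qs2]]]]]].
  by exists (t + u), s2; split=> //; [apply: exec_seq e1 e2 | apply: leq_add].
- case=> yes no; have [rs|rs] := boolP (regs s r == 0).
    have [t [s1 [e1 tq Qs1]]] := IHq _ _ (no rs).
    exists t.+1, s1; split=> //; first exact: exec_if_false.
    by rewrite ltnS leq_max tq orbT.
  have [t [s1 [e1 tp Qs1]]] := IHp _ _ (yes rs).
  exists t.+1, s1; split=> //; first exact: exec_if_true.
  by rewrite ltnS leq_max tp.
Qed.

Lemma runs_seq W p q s T U R Q :
  runs W p s T R -> (forall s', R s' -> runs W q s' U Q) ->
  runs W (Seq p q) s (T + U) Q.
Proof.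
move=> [t [s1 [e1 tp /[swap] /[apply] -[u [s2 [e2 uq Qs2]]]]]].
by exists (t + u), s2; split=> //; [apply: exec_seq e1 e2 | apply: leq_add].
Qed.

Lemma runs_if W r p q s T Q :
  (regs s r != 0 -> runs W p s T Q) -> (regs s r == 0 -> runs W q s T Q) ->
  runs W (If r p q) s T.+1 Q.
Proof.
move=> yes no; have [rs|rs] := boolP (regs s r == 0).
  have [t [s1 [e1 tq Qs1]]] := no rs.
  by exists t.+1, s1; split=> //; apply: exec_if_false.
have [t [s1 [e1 tp Qs1]]] := yes rs.
by exists t.+1, s1; split=> //; apply: exec_if_true.
Qed.

Lemma runs_weaken W p s T T' (Q Q' : state -> Prop) :
  runs W p s T Q -> T <= T' -> (forall s', Q s' -> Q' s') -> runs W p s T' Q'.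
Proof.
move=> [t [s' [e1 tT Qs]]] TT' QQ'.
by exists t, s'; split=> //; [apply: leq_trans TT' | apply: QQ'].
Qed.

(** The index of the invariant is a variant: at most [k] rounds, each costing the body and one test,
    and a last failing test. *)
Lemma runs_while W r p (I : nat -> state -> Prop) C k s :
  (forall k s, I k s -> regs s r != 0 ->
     runs W p s C (fun s' => exists2 k', k' < k & I k' s')) ->
  I k s ->
  runs W (While r p) s (C.+1 * k).+1
    (fun s' => regs s' r = 0 /\ exists k', I k' s').
Proof.
move=> step; elim/ltn_ind: k s => k IH s Iks.
have [rs|rs] := boolP (regs s r == 0).
  by exists 1, s; split=> //; [apply: exec_while_stop | split; [apply/eqP | exists k]].
have [t [s1 [e1 tC [k' ltk Is1]]]] := step _ _ Iks rs.
have [u [s2 [e2 uT Qs2]]] := IH _ ltk _ Is1.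
exists (t + u).+1, s2; split=> //; first exact: exec_while_step e1 e2.
rewrite ltnS; apply: leq_trans (leq_add tC uT) _.
by rewrite -addSnnS -mulnS leq_mul2l ltk orbT.
Qed.

(** * Linked lists and depth-first search *)

Section LinkedLists.

(** Address 0 is the null pointer, so no cell may sit there. *)
Fixpoint is_list (next : nat -> nat) (ptr : nat) (l : seq nat) : Prop :=
  if l is a :: l' then [/\ ptr = a, a != 0 & is_list next (next a) l'] else ptr = 0.

Lemma is_list_eq next next' ptr l :
  {in l, next =1 next'} -> is_list next ptr l -> is_list next' ptr l.
Proof.
elim: l ptr => [|a l IH] ptr //= E [-> a0 il]; split=> //.
rewrite -E ?mem_head //; apply: IH il => b bl; apply: E.
by rewrite inE bl orbT.
Qed.

Lemma is_list_nil next l : is_list next 0 l -> l = [::].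
Proof. by case: l => //= a l [<-]. Qed.

Lemma is_list_cons next ptr l : ptr != 0 -> is_list next ptr l ->
  exists2 l', l = ptr :: l' & is_list next (next ptr) l'.
Proof.
by case: l => [|a l] /= p0 => [E|[-> _ il]]; [rewrite E in p0 | exists l].
Qed.

Definition update (L : nat -> seq nat) u l := fun v => if v == u then l else L v.

Variables (n D : nat).

(** The old length is added on the left instead of subtracted on the right, to avoid truncated
    subtraction. The free summand [f] makes room for the weight of unvisited vertices. *)
Lemma sum_update L f u l : u < n ->
  \sum_(v < n) (size (update L u l v) + f v) + size (L u) =
  \sum_(v < n) (size (L v) + f v) + size l.
Proof.
move=> un; rewrite (bigD1 (Ordinal un)) //= [in RHS](bigD1 (Ordinal un)) //=.
rewrite {1}/update eqxx.
rewrite (eq_bigr (fun v : 'I_n => size (L v) + f v)); first by lia.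
by move=> v vu; rewrite /update; have -> : (v == u :> nat) = false by apply: negbTE.
Qed.

Lemma sum_flip (L : nat -> seq nat) (f g : nat -> nat) u : u < n -> {in predC1 u, f =1 g} ->
  \sum_(v < n) (size (L v) + f v) + g u = \sum_(v < n) (size (L v) + g v) + f u.
Proof.
move=> un E; rewrite (bigD1 (Ordinal un)) //= [in RHS](bigD1 (Ordinal un)) //=.
rewrite (eq_bigr (fun v : 'I_n => size (L v) + g v)); first by lia.
by move=> v vu; rewrite E.
Qed.

(* Heads of the lists are at [2 * D + v], successors of cells at [D + a]. *)
Definition stores (M : nat -> nat) (L : nat -> seq nat) B : Prop :=
  forall v, v < n -> is_list (fun a => M (D + a)) (M (2 * D + v)) (L v) /\
                     {in L v, forall a, a < B}.

Lemma upd_same f i v : upd f i v i = v.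
Proof. by rewrite /upd eqxx. Qed.

Lemma upd_other f i v j : j != i -> upd f i v j = f j.
Proof. by rewrite /upd => /negbTE->. Qed.

(** All list cells lie below [B], so [q] is fresh; [q < D] keeps its link cell out of the array of
    heads. *)
Lemma stores_push M L B u q : stores M L B -> 0 < q -> B <= q < D -> u < n ->
  stores (upd (upd M (D + q) (M (2 * D + u))) (2 * D + u) q) (update L u (q :: L u)) q.+1.
Proof.
move=> st q0 /andP[Bq qD] un v vn; rewrite /update.
have frame w : w < n ->
    is_list (fun a => upd (upd M (D + q) (M (2 * D + u))) (2 * D + u) q (D + a))
      (M (2 * D + w)) (L w).
  move=> wn; apply: is_list_eq (proj1 (st _ wn)) => a /(proj2 (st _ wn)) aB.
  by rewrite !upd_other //; lia.
have [->|vu] := eqVneq v u; last first.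
  split; last by move=> a /(proj2 (st _ vn)); lia.
  by rewrite upd_other ?upd_other; [exact: frame | lia | lia].
split; last by move=> a; rewrite inE => /predU1P[->//|/(proj2 (st _ un))]; lia.
rewrite upd_same /=; split=> //; first by lia.
by rewrite upd_other ?upd_same; [exact: frame | lia].
Qed.

Lemma stores_pop M L B u e l : stores M L B -> B <= D -> u < n -> L u = e :: l ->
  stores (upd M (2 * D + u) (M (D + e))) (update L u l) B.
Proof.
move=> st BD un Lu v vn; rewrite /update.
have frame p l' : {in l', forall a, a < B} -> is_list (fun a => M (D + a)) p l' ->
    is_list (fun a => upd M (2 * D + u) (M (D + e)) (D + a)) p l'.
  by move=> lB; apply: is_list_eq => a /lB aB; rewrite upd_other //; lia.
have [->|vu] := eqVneq v u; last first.
  split; last exact: (proj2 (st _ vn)).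
  rewrite upd_other; last by lia.
  by apply: frame (proj1 (st _ vn)); apply: (proj2 (st _ vn)).
have [] := st _ un; rewrite Lu => -[_ _ il] lB.
have lB' : {in l, forall a, a < B} by move=> a al; apply: lB; rewrite inE al orbT.
by split=> //; rewrite upd_same; apply: frame.
Qed.

Lemma stores_frame M L B a x : stores M L B -> B <= D -> n <= D -> 3 * D <= a ->
  stores (upd M a x) L B.
Proof.
move=> st BD nD aD v vn; have [il lB] := st _ vn; split=> //.
rewrite upd_other; last by lia.
by apply: is_list_eq il => b /lB bB; rewrite upd_other //; lia.
Qed.

End LinkedLists.

(** * Invariant and potential of the depth-first search *)

Section Search.
Variables (n D root : nat) (E : nat -> nat) (L0 : nat -> seq nat) (P : nat -> Prop).
Hypothesis nD : n < D.
Hypothesis L0E : forall v a, v < n -> a \in L0 v -> E a < n.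
Hypothesis Pclosed : forall v a, v < n -> P v -> a \in L0 v -> P (E a).

Definition visited (M : nat -> nat) v := M (3 * D + v.+1) != 0.

(* A vertex [v] is pushed as the nonzero pointer [v.+1]; its link cell holds the
   successor of the rest of the stack, so it doubles as the visited mark. *)
Record dfs_inv M top L S : Prop := DfsInv {
  dfs_stores : stores n D M L D;
  dfs_stack : is_list (fun a => (M (3 * D + a)).-1) top S;
  dfs_stackP : {in S, forall a, [/\ 0 < a, a <= n & M (3 * D + a) != 0]};
  dfs_input : forall a, a < D -> M a = E a;
  dfs_done : forall v, v < n -> visited M v -> v.+1 \in S \/ L v = [::];
  dfs_sound : forall v, v < n -> visited M v -> P v;
  dfs_sub : forall v, v < n -> {subset L v <= L0 v};
  dfs_closed : forall v a, v < n -> a \in L0 v -> a \in L v \/ visited M (E a);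
  dfs_root : visited M root }.

(** Every round pops a vertex or consumes a half-edge. If it also pushes a vertex, marking that
    vertex releases weight 2, more than the growth of the stack. *)
Definition potential M (L : nat -> seq nat) (S : seq nat) :=
  \sum_(v < n) (size (L v) + 2 * ~~ visited M v) + size S.

Lemma dfs_top M top L S : top != 0 -> dfs_inv M top L S ->
  exists2 S', S = top :: S' &
    [/\ top.-1.+1 = top, top.-1 < n & is_list (fun a => (M (3 * D + a)).-1) (M (3 * D + top)).-1 S'].
Proof.
move=> t0 inv; have [S' ES il] := is_list_cons t0 (dfs_stack inv).
exists S' => //; have [|t1 tn _] := dfs_stackP inv (x := top).
  by rewrite ES mem_head.
by rewrite prednK.
Qed.

Lemma dfs_pop M top L S : top != 0 -> M (2 * D + top.-1) = 0 -> dfs_inv M top L S ->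
  exists S', dfs_inv M (M (3 * D + top)).-1 L S' /\ potential M L S' < potential M L S.
Proof.
move=> t0 hd0 inv; have [S' ES [tK tn il]] := dfs_top t0 inv.
exists S'; split; last by rewrite /potential ES ltn_add2l.
case: inv => st sk skP inp dn snd sb cl rt; split=> //.
  by move=> a aS; apply: skP; rewrite ES inE aS orbT.
move=> v vn vv; have [|] := dn v vn vv; last by right.
rewrite ES inE => /predU1P[vt|]; last by left.
have := proj1 (st _ tn); rewrite hd0 => /is_list_nil; rewrite -vt /=.
by right.
Qed.

Lemma dfs_head M top L S (e := M (2 * D + top.-1)) : top != 0 -> dfs_inv M top L S -> e != 0 ->
  exists2 l, L top.-1 = e :: l & [/\ e < D, E e < n & e \in L0 top.-1].
Proof.
move=> t0 inv e0; have [S' ES [tK tn _]] := dfs_top t0 inv.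
have [il lB] := dfs_stores inv tn.
have [l Lu _] := is_list_cons e0 il; exists l => //.
have eL : e \in L top.-1 by rewrite Lu mem_head.
have eL0 := dfs_sub inv tn eL.
by split=> //; [exact: lB | exact: L0E eL0].
Qed.

Lemma dfs_skip M top L S (e := M (2 * D + top.-1)) :
  top != 0 -> dfs_inv M top L S -> e != 0 -> M (3 * D + (E e).+1) != 0 ->
  exists L', dfs_inv (upd M (2 * D + top.-1) (M (D + e))) top L' S /\
    potential (upd M (2 * D + top.-1) (M (D + e))) L' S < potential M L S.
Proof.
move=> t0 inv e0 ve; set M' := upd _ _ _.
have M'O j : j != 2 * D + top.-1 -> M' j = M j by apply: upd_other.
have [S' ES [tK tn _]] := dfs_top t0 inv.
have [l Lu [eD En eL0]] := dfs_head t0 inv e0.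
have visE v : visited M' v = visited M v.
  by rewrite /visited M'O //; lia.
exists (update L top.-1 l); split; last first.
  rewrite /potential ltn_add2r.
  under eq_bigr do rewrite visE.
  by have := sum_update L (fun v => 2 * ~~ visited M v) l tn; rewrite Lu /=; lia.
case: inv => st sk skP inp dn snd sb cl rt; split.
- exact: stores_pop st _ _ Lu.
- by apply: is_list_eq sk => a aS; rewrite M'O //; have [] := skP a aS; lia.
- by move=> a /skP [a0 an Ma]; split=> //; rewrite M'O //; lia.
- by move=> a aD; rewrite M'O ?inp //; lia.
- move=> v vn; rewrite visE => /(dn v vn)[]; first by left.
  rewrite /update; have [->|_] := eqVneq v top.-1; last by right.
  by rewrite Lu.
- by move=> v vn; rewrite visE; apply: snd.
- move=> v vn a; rewrite /update; case: eqP => [Ev al|_]; last exact: sb.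
  by rewrite Ev; apply: sb => //; rewrite Lu inE al orbT.
- move=> v a vn /(cl v a vn); rewrite visE /update; case: eqP => [->|_] //.
  by rewrite Lu inE => -[/predU1P[->|]|]; [right | left | right].
- by rewrite visE.
Qed.

Lemma dfs_push M top L S (e := M (2 * D + top.-1))
    (M' := upd (upd M (2 * D + top.-1) (M (D + e))) (3 * D + (E e).+1) top.+1) :
  top != 0 -> dfs_inv M top L S -> e != 0 -> M (3 * D + (E e).+1) = 0 ->
  exists L' S', dfs_inv M' (E e).+1 L' S' /\ potential M' L' S' < potential M L S.
Proof.
move=> t0 inv e0 nve.
have [S' ES [tK tn _]] := dfs_top t0 inv.
have [l Lu [eD En eL0]] := dfs_head t0 inv e0.
have M'O j : j != 2 * D + top.-1 -> j != 3 * D + (E e).+1 -> M' j = M j.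
  by move=> j1 j2; rewrite /M' !upd_other.
have M'E : M' (3 * D + (E e).+1) = top.+1 by apply: upd_same.
have visE v : visited M' v = (v == E e) || visited M v.
  rewrite /visited; have [->|vE] := eqVneq v (E e); first by rewrite M'E.
  by rewrite M'O //; lia.
(* Link cells in use are nonzero while the cell of the new vertex is still zero, so the write misses
   the old stack. *)
have frame a : M (3 * D + a) != 0 -> M' (3 * D + a) = M (3 * D + a).
  move=> Ma; rewrite M'O //; first by lia.
  by apply: contraNneq Ma => ->; rewrite nve.
exists (update L top.-1 l), ((E e).+1 :: S); split; last first.
  rewrite /potential.
  have := sum_update L (fun v => 2 * ~~ visited M v) l tn; rewrite Lu /=.
  have flip : {in predC1 (E e), (fun v => 2 * ~~ visited M' v) =1 (fun v => 2 * ~~ visited M v)}.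
    by move=> v; rewrite inE visE => /negbTE->.
  have := sum_flip (update L top.-1 l) En flip.
  by rewrite /= visE eqxx {2}/visited nve eqxx /=; lia.
case: inv => st sk skP inp dn snd sb cl rt; split.
- apply: stores_frame; [exact: stores_pop st _ _ Lu | by [] | lia | lia].
- rewrite /= M'E; split=> //.
  by apply: is_list_eq sk => a aS; rewrite frame //; have [] := skP a aS.
- move=> a; rewrite inE => /predU1P[->|/skP [a0 an Ma]]; last by rewrite frame.
  by rewrite M'E.
- by move=> a aD; rewrite M'O ?inp //; lia.
- move=> v vn; rewrite visE => /predU1P[->|]; first by left; rewrite mem_head.
  move=> /(dn v vn)[]; first by left; rewrite inE; apply/orP; right.
  rewrite /update; have [->|_] := eqVneq v top.-1; last by right.
  by rewrite Lu.
- move=> v vn; rewrite visE => /predU1P[->|]; last exact: snd.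
  apply: (Pclosed tn _ eL0); apply: snd => //.
  by rewrite /visited tK; have [|] := skP top; rewrite // ES mem_head.
- move=> v vn a; rewrite /update; case: eqP => [Ev al|_]; last exact: sb.
  by rewrite Ev; apply: sb => //; rewrite Lu inE al orbT.
- move=> v a vn /(cl v a vn); rewrite visE /update; case: eqP => [->|_].
    by rewrite Lu inE => -[/predU1P[->|]|->]; [right; rewrite eqxx | left | right; rewrite orbT].
  by case=> [|->]; [left | right; rewrite orbT].
- by rewrite visE rt orbT.
Qed.

(** With an empty stack, visited vertices have exhausted lists, and each consumed half-edge leads to
    a visited vertex; so the visited set is closed under edges. *)
Lemma dfs_end M L S : dfs_inv M 0 L S ->
  [/\ visited M root, forall v, v < n -> visited M v -> P v
    & forall v a, v < n -> visited M v -> a \in L0 v -> visited M (E a)].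
Proof.
case=> st sk skP inp dn snd sb cl rt; split=> // v a vn vv aL.
have S0 := is_list_nil sk.
have [|//] := cl v a vn aL.
by have [|->] := dn v vn vv; rewrite ?S0.
Qed.

End Search.

(** * The program *)

Declare Scope prog_scope.
Local Notation "p ;; q" := (Seq p q) (at level 60, right associativity) : prog_scope.
Local Open Scope prog_scope.

(* Registers: 0 output, 1 the constant 1, 2-4 the bases D, 2D, 3D of the arrays of
   list successors, list heads and stack links, where D exceeds the length of the
   input, 5 the current half-edge or the top of the stack, 6 the number of edges
   left, 7-12 scratch, 13-14 the sizes of the two trees (later scratch), 15 and 17
   the target and the root of the search, 16 the number of vertices.
   A half-edge is the input cell of one endpoint of an edge; it is a list cell of
   the other endpoint, so that its content is the neighbour. *)
Definition build_body : prog :=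
  Add 12 5 1;; LoadMem 7 5;; LoadMem 8 12;;
  Add 9 3 8;; LoadMem 10 9;; Add 11 2 5;; StoreMem 11 10;; StoreMem 9 5;;
  Add 9 3 7;; LoadMem 10 9;; Add 11 2 12;; StoreMem 11 10;; StoreMem 9 12;;
  Add 5 12 1;; Defs.Sub 6 6 1.

Definition dfs_body : prog :=
  Defs.Sub 7 5 1;; Add 9 3 7;; LoadMem 12 9;;
  If 12
    (LoadMem 8 12;; Add 8 8 1;; Add 11 4 8;; LoadMem 10 11;;
     Add 13 2 12;; LoadMem 14 13;; StoreMem 9 14;;
     If 10 Skip (Add 10 5 1;; StoreMem 11 10;; Add 5 8 0))
    (Add 9 4 5;; LoadMem 10 9;; Defs.Sub 5 10 1).

Definition layout : prog :=
  Add 7 5 6;; Add 7 7 6;; LoadMem 17 7;; Add 7 7 13;; Add 7 7 13;; LoadMem 15 7;;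
  Add 7 7 14;; Add 7 7 14;; Add 7 7 16;; Add 2 7 1;; Add 3 2 2;; Add 4 3 2.

Definition start : prog := Add 5 17 1;; Add 9 4 5;; StoreMem 9 1.

Definition answer : prog :=
  Add 9 15 1;; Add 9 4 9;; LoadMem 10 9;; If 10 (Const 0 1) Skip.

Definition search : prog :=
  layout;; While 6 build_body;; start;; While 5 dfs_body;; answer.

Definition read_header : prog :=
  Const 1 1;; LoadMem 16 0;; LoadMem 6 1;; Add 7 1 1;; LoadMem 13 7;;
  Add 7 7 1;; LoadMem 14 7;; Add 5 7 1;;
  Defs.Sub 7 13 14;; Defs.Sub 8 14 13;; Add 8 8 7;; Defs.Sub 7 13 1.

Definition solver : prog :=
  read_header;; If 8 Skip (If 7 search (Const 0 1)).

(* Registers are literals, memory addresses are not: only the former simplify. *)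
Arguments upd f !i v !j /.

(** * Correctness and running time of the search program *)

Section Machine.
Variables (W n m D root target : nat) (E : nat -> nat) (P : nat -> Prop).

(** The offsets 4 and 5 skip the four header words: edge [j] occupies cells [4 + 2 * j] and
    [5 + 2 * j], and each cell goes into the list of the endpoint stored in the other. *)
Definition half_edge i v a := exists2 j, j < i &
  (a = 4 + 2 * j /\ v = E (5 + 2 * j)) \/ (a = 5 + 2 * j /\ v = E (4 + 2 * j)).

Definition joined v w := exists2 a, half_edge m v a & E a = w.

Hypotheses (nD : n < D) (mD : 4 + 2 * m <= D) (DW : 4 * D <= W).
Hypothesis Ebound : forall a, 4 <= a < 4 + 2 * m -> E a < n.
Hypothesis E0 : forall a, D <= a -> E a = 0.
Hypothesis rootn : root < n.
Hypothesis targetn : target < n.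
Hypothesis Proot : P root.
Hypothesis Pclosed : forall v w, P v -> joined v w -> P w.

Record consts s : Prop := Consts {
  r0 : regs s 0 = 0;
  r1 : regs s 1 = 1;
  r2 : regs s 2 = D;
  r3 : regs s 3 = 2 * D;
  r4 : regs s 4 = 3 * D;
  r15 : regs s 15 = target;
  r17 : regs s 17 = root }.

Record build_inv i M L : Prop := BuildInv {
  build_le : i <= m;
  build_stores : stores n D M L (4 + 2 * i);
  build_input : forall a, a < D -> M a = E a;
  build_zero : forall a, 3 * D <= a -> M a = 0;
  build_sum : \sum_(v < n) (size (L v) + 0) = 2 * i;
  build_half : forall v a, v < n -> a \in L v <-> half_edge i v a }.

Lemma build_init : build_inv 0 E (fun=> [::]).
Proof.
split=> //.
- by move=> v vn; split=> //=; apply: E0; lia.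
- by move=> a aD; apply: E0; lia.
- by rewrite big1.
- by move=> v a vn; split=> // -[].
Qed.

Lemma build_step i M L (p := 4 + 2 * i) (q := p + 1) (u := E p) (v := E q)
    (M1 := upd (upd M (D + p) (M (2 * D + v))) (2 * D + v) p)
    (M2 := upd (upd M1 (D + q) (M1 (2 * D + u))) (2 * D + u) q) :
  i < m -> build_inv i M L -> exists L', build_inv i.+1 M2 L'.
Proof.
move=> im [_ st inp zr sm hf].
have un : u < n by apply: Ebound; rewrite /p; lia.
have vn : v < n by apply: Ebound; rewrite /q /p; lia.
have st1 : stores n D M1 (update L v (p :: L v)) p.+1.
  by apply: (stores_push st) => //; rewrite /p; lia.
(* The updates are nested in program order: the second push reads the lists as left by the first. *)
exists (update (update L v (p :: L v)) u (q :: update L v (p :: L v) u)); split=> //.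
- have -> : 4 + 2 * i.+1 = q.+1 by rewrite /q /p; lia.
  by apply: (stores_push st1) => //; rewrite /q /p; lia.
- by move=> a aD; rewrite /M2 /M1 !upd_other ?inp //; rewrite /q /p; lia.
- by move=> a aD; rewrite /M2 /M1 !upd_other ?zr //; rewrite /q /p; lia.
- have := sum_update L (fun=> 0) (p :: L v) vn.
  have := sum_update (update L v (p :: L v)) (fun=> 0) (q :: update L v (p :: L v) u) un.
  by rewrite sm /=; lia.
move=> w a wn; rewrite /update; split.
  have old : a \in L w -> half_edge i.+1 w a.
    by move=> /(hf _ _ wn)[j ji H]; exists j => //; apply: ltnW.
  have new1 : w = v -> a = p -> half_edge i.+1 w a.
    move=> -> ->; exists i => //; left; split=> //.
    by rewrite /v /q /p; congr E; lia.
  have new2 : w = u -> a = q -> half_edge i.+1 w a.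
    by move=> -> ->; exists i => //; right; split=> //; rewrite /q /p; lia.
  case: eqP => [wu|_].
    rewrite inE => /predU1P[|]; first exact: new2.
    rewrite -wu; case: eqP => [wv|_]; last exact: old.
    by rewrite -wv inE => /predU1P[|]; [exact: new1 | exact: old].
  case: eqP => [wv|_]; last exact: old.
  by rewrite -wv inE => /predU1P[|]; [exact: new1 | exact: old].
case=> j; rewrite ltnS leq_eqVlt => /predU1P[->|ji] H; last first.
  have aL : a \in L w by apply/(hf _ _ wn); exists j.
  case: eqP => [wu|_]; rewrite -?wu; case: eqP => [wv|_]; by rewrite -?wv ?inE ?aL ?orbT.
have qE : q = 5 + 2 * i by rewrite /q /p; lia.
case: H => -[-> wE].
  have wv : w = v by rewrite wE /v qE.
  by rewrite wv eqxx; case: eqP => [<-|_]; rewrite ?eqxx !inE eqxx ?orbT.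
by have -> : w = u by []; rewrite eqxx inE qE eqxx.
Qed.

(** The factor 16 counts the fifteen instructions of the body and the loop test. *)
Lemma build_loop s : consts s -> regs s 5 = 4 -> regs s 6 = m -> Defs.mem s =1 E ->
  runs W (While 6 build_body) s (16 * m).+1
    (fun s' => consts s' /\ exists L, build_inv m (Defs.mem s') L).
Proof.
move=> cs s5 s6 sm.
pose I k s := consts s /\ exists i L, [/\ k = m - i, regs s 6 = m - i, regs s 5 = 4 + 2 * i
   & build_inv i (Defs.mem s) L].
have init : I m s.
  split=> //; exists 0, (fun=> [::]); rewrite subn0 s6 s5; split=> //.
  case: build_init => a b c d e f; split=> //; try by move=> ? ?; rewrite sm; auto.
  by move=> v vn; rewrite sm; have [il lB] := b v vn; split=> //.
apply: runs_weaken (@runs_while _ _ _ I (cost build_body) m s _ init) _ _.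
- move=> k {cs s5 s6 sm init}s [cs [i [L [kE s6 s5 inv]]]] im.
  have im' : i < m by rewrite s6 in im; lia.
  have [L' inv'] := build_step im' inv.
  have pD : 4 + 2 * i < D by lia.
  have qD : 4 + 2 * i + 1 < D by lia.
  have mp := build_input inv pD; have mq := build_input inv qD.
  have un : E (4 + 2 * i) < n by apply: Ebound; lia.
  have vn : E (4 + 2 * i + 1) < n by apply: Ebound; lia.
  apply: wp_runs; case: (cs) => e0 e1 e2 e3 e4 e15 e17 /=.
  rewrite e1 s5 ?e2 ?e3 mp mq.
  repeat (split; first by lia).
  exists (m - i.+1); first by lia.
  split; first by split.
  exists i.+1, L'; split=> //=; [by rewrite s6; lia | by lia].
- by rewrite mulnC.
- move=> s' [s'6 [k' [cs' [i [L [_ s6' _ inv]]]]]]; split=> //; exists L.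
  have <- // : i = m by have := build_le inv; rewrite s'6 in s6'; lia.
Qed.

Section Dfs.
Variable L0 : nat -> seq nat.
Hypothesis L0P : forall v a, v < n -> a \in L0 v <-> half_edge m v a.
Hypothesis L0sum : \sum_(v < n) (size (L0 v) + 0) = 2 * m.

Lemma half_bound v a : half_edge m v a -> E a < n.
Proof. by case=> j jm [] [-> _]; apply: Ebound; lia. Qed.

Lemma dfs_init M : build_inv m M L0 ->
  dfs_inv n D root E L0 P (upd M (3 * D + root.+1) 1) root.+1 L0 [:: root.+1].
Proof.
case=> _ st inp zr _ _; split=> //.
- apply: stores_frame; [|lia|lia|lia] => v vn.
  by have [il lB] := st v vn; split=> // a /lB; lia.
- by rewrite /= upd_same.
- by move=> a; rewrite inE => /eqP->; rewrite upd_same.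
- by move=> a aD; rewrite upd_other ?inp //; lia.
- move=> v vn; rewrite /visited; have [->|vr] := eqVneq v root.
    by left; rewrite mem_head.
  by rewrite upd_other ?zr //; lia.
- move=> v vn; rewrite /visited; have [-> //|vr] := eqVneq v root.
  by rewrite upd_other ?zr //; lia.
- by move=> v vn a.
- by move=> v a vn aL; left.
- by rewrite /visited upd_same.
Qed.

(** The initial potential is at most 2 per vertex, plus the [2 * m] half-edges, plus the root on the
    stack; 17 bounds a round with its test. *)
Lemma dfs_loop s : consts s -> regs s 5 = root.+1 ->
  dfs_inv n D root E L0 P (Defs.mem s) root.+1 L0 [:: root.+1] ->
  runs W (While 5 dfs_body) s (17 * (2 * n + 2 * m + 1)).+1
    (fun s' => consts s' /\ exists L S, dfs_inv n D root E L0 P (Defs.mem s') 0 L S).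
Proof.
move=> cs s5 inv.
have L0E v a : v < n -> a \in L0 v -> E a < n by move=> vn /(L0P _ vn) /half_bound.
have Pcl v a : v < n -> P v -> a \in L0 v -> P (E a).
  by move=> vn Pv /(L0P _ vn) h; apply: (Pclosed Pv); exists a.
pose I k s := consts s /\ exists L S, dfs_inv n D root E L0 P (Defs.mem s) (regs s 5) L S
   /\ k = potential n D (Defs.mem s) L S.
have init : I (potential n D (Defs.mem s) L0 [:: root.+1]) s.
  by split=> //; exists L0, [:: root.+1]; rewrite s5.
apply: runs_weaken (@runs_while _ _ _ I (cost dfs_body) _ s _ init) _ _.
- move=> k {cs s5 inv init}s [cs [L [S [inv ->]]]] t0.
  move Et : (regs s 5) inv t0 => top inv t0.
  have [S' ES [tK tn _]] := dfs_top t0 inv.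
  apply: wp_runs; case: (cs) => e0 e1 e2 e3 e4 e15 e17 /=.
  rewrite ?(e0, e1, e2, e3, e4) Et.
  have -> : top - 1 = top.-1 by lia.
  split; first by lia.
  split; last first.
    move=> /eqP hd0; split; first by lia.
    have [S1 [inv1 pot]] := dfs_pop t0 hd0 inv.
    exists (potential n D (Defs.mem s) L S1) => //; split; first by split.
    by exists L, S1; rewrite /= subn1.
  set e := Defs.mem s _ => ne0.
  have [l Lu [eD En eL0]] := dfs_head L0E t0 inv ne0.
  rewrite -/e in eD En eL0.
  have -> : Defs.mem s e = E e by apply: (dfs_input inv).
  (* Register 0 stays 0 until the answer is written, so [Add 5 8 0] is a plain copy. *)
  rewrite addn0 !addn1.
  do 3 (split; first by lia).
  split.
    move=> ve.
    have [L1 [inv1 pot]] := dfs_skip nD L0E t0 inv ne0 ve.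
    eexists; first exact: pot.
    split; first by split.
    by exists L1, S; rewrite /= Et.
  move=> /eqP nve.
  have [L1 [S1 [inv1 pot]]] := dfs_push nD L0E Pcl t0 inv ne0 nve.
  split; first by lia.
  split; first by lia.
  eexists; first exact: pot.
  split; first by split.
  by exists L1, S1.
- rewrite ltnS; apply: leq_mul => //; rewrite /potential leq_add2r big_split /= addnC.
  apply: leq_add; last by rewrite -L0sum; apply: leq_sum => v _; rewrite addn0.
  rewrite [2 * n]mulnC -[n in n * 2]card_ord -sum_nat_const.
  by apply: leq_sum => v _; case: (visited _ _ _).
- move=> s' [s'5 [k' [cs' [L [S [inv' _]]]]]]; split=> //; exists L, S.
  by rewrite -s'5.
Qed.

End Dfs.


Record ready s : Prop := Ready {
  ready0 : regs s 0 = 0;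
  ready1 : regs s 1 = 1;
  ready5 : regs s 5 = 4;
  ready6 : regs s 6 = m;
  ready16 : regs s 16 = n;
  ready_mem : Defs.mem s =1 E }.

Lemma search_runs ks kt s : ready s -> regs s 13 = ks -> regs s 14 = kt ->
  D = 4 + 2 * m + 2 * ks + 2 * kt + n + 1 ->
  root = E (4 + 2 * m) -> target = E (4 + 2 * m + 2 * ks) ->
  runs W search s (34 * n + 50 * m + 40) (fun s' => exists vis : pred nat,
    [/\ vis root, forall v, v < n -> vis v -> P v,
      forall v w, v < n -> vis v -> joined v w -> vis w
      & output s' = vis target]).
Proof.
case=> e0 e1 e5 e6 e16 sE e13 e14 DE rootE targetE.
(* The five summands are the costs of [layout], the building loop, [start], the search loop and
   [answer]. *)
apply: runs_weaken (_ : _ (12 + ((16 * m).+1 + (3 + ((17 * (2 * n + 2 * m + 1)).+1 + 5)))) _) _ (fun s' h => h); last by lia.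
pose R1 s' := [/\ consts s', regs s' 5 = 4, regs s' 6 = m & Defs.mem s' =1 E].
apply: (runs_seq (R := R1)).
  apply: wp_runs => /=.
  rewrite e1 e5 e6 e13 e14 e16 !sE.
  have -> : 4 + m + m = 4 + 2 * m by lia.
  have -> : 4 + 2 * m + ks + ks = 4 + 2 * m + 2 * ks by lia.
  have -> : 4 + 2 * m + 2 * ks + kt + kt + n + 1 = D by lia.
  do 10 (split; first by lia).
  by split=> //; split=> //=; lia.
move=> s1 [c1 s15 s16 s1E].
apply: runs_seq (build_loop c1 s15 s16 s1E) _ => s2 [c2 [L0 inv2]].
have L0P := build_half inv2; have L0sum := build_sum inv2.
pose R3 s' := [/\ consts s', regs s' 5 = root.+1 &
  dfs_inv n D root E L0 P (Defs.mem s') root.+1 L0 [:: root.+1]].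
apply: (runs_seq (R := R3)).
  apply: wp_runs => /=; case: (c2) => f0 f1 f2 f3 f4 f15 f17.
  rewrite f1 f4 f17 addn1.
  do 2 (split; first by lia).
  split=> //; exact: dfs_init inv2.
move=> s3 [c3 s35 inv3].
apply: runs_seq (dfs_loop L0P L0sum c3 s35 inv3) _ => s4 [c4 [L [S inv4]]].
have [vroot vP vcl] := dfs_end inv4.
apply: wp_runs => /=; case: c4 => f0 f1 f2 f3 f4 f15 f17.
rewrite f1 f4 f15 f0 addn1.
do 2 (split; first by lia).
have post o : o = visited D (Defs.mem s4) target :> nat ->
  exists vis : pred nat, [/\ vis root, forall v, v < n -> vis v -> P v,
      forall v w, v < n -> vis v -> joined v w -> vis w
      & o = vis target].
  move=> oE; exists (visited D (Defs.mem s4)); split=> //.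
  by move=> v w vn vv [a h <-]; apply: (vcl v a) => //; apply/(L0P _ _ vn).
split; last by move=> /eqP v0; apply: post; rewrite /visited v0.
by move=> v0; split; [lia | apply: post; rewrite /visited v0].
Qed.

End Machine.

(** * Reading the encoded input *)

Section Encoding.
Variable n : nat.
Implicit Types (s : seq ('I_n * 'I_n)) (F : {set {set 'I_n}}).

Lemma size_endpoints s : size (endpoints s) = 2 * size s.
Proof. by elim: s => //= e s IH; rewrite IH mulnS. Qed.

Lemma nth_endpoints s e0 j : j < size s ->
  nth 0 (endpoints s) (2 * j) = (nth e0 s j).1 /\
  nth 0 (endpoints s) (2 * j).+1 = (nth e0 s j).2.
Proof.
elim: s j => [|e s IH] [|j] //; rewrite ltnS mulnS !addSn add0n; exact: IH.
Qed.

Lemma edge_list_size F s : edge_list F s -> size s = #|F|.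
Proof. by case=> us eF; rewrite -(eq_card eF) (card_uniqP us) size_map. Qed.

Lemma edge_listP F s x y : edge_list F s ->
  [set x; y] \in F <-> exists2 e, e \in s & e = (x, y) \/ e = (y, x).
Proof.
case=> _ eF; rewrite -eF; split.
  case/mapP=> -[a b] abs /= /eq_pair[] [-> ->]; exists (a, b); auto.
by case=> e es [] E; apply/mapP; exists e => //; rewrite E //= setUC.
Qed.

Lemma edge_list_head F s e : edge_list F s -> 0 < size s -> (nth e s 0).1 \in cover F.
Proof.
case=> _ eF s0; set f := nth e s 0; apply/bigcupP; exists [set f.1; f.2]; last exact: set21.
by rewrite -eF; apply/mapP; exists f => //; apply: mem_nth.
Qed.

Variables (gs ss ts : seq ('I_n * 'I_n)).
Let E := nth 0 (encoding gs ss ts).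

Lemma encoding_large a :
  4 + 2 * size gs + 2 * size ss + 2 * size ts <= a -> E a = 0.
Proof.
by move=> le_a; apply: nth_default; rewrite /encoding !size_cat !size_endpoints /=; lia.
Qed.

Lemma nth_encoding a :
  E (4 + a) = nth 0 (endpoints gs ++ endpoints ss ++ endpoints ts) a.
Proof. by []. Qed.

Lemma encoding_gs a : a < 2 * size gs -> E (4 + a) = nth 0 (endpoints gs) a.
Proof. by move=> lt_a; rewrite nth_encoding nth_cat size_endpoints lt_a. Qed.

Lemma encoding_ss a : a < 2 * size ss ->
  E (4 + 2 * size gs + a) = nth 0 (endpoints ss) a.
Proof.
move=> lt_a; rewrite -addnA nth_encoding nth_cat size_endpoints.
by rewrite ltnNge leq_addr addKn nth_cat size_endpoints lt_a.
Qed.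

(** The target list comes last, so past its end both sides are the default 0 and no bound on [a]
    appears. *)
Lemma encoding_ts a : E (4 + 2 * size gs + 2 * size ss + a) = nth 0 (endpoints ts) a.
Proof.
rewrite -addnA -[4 + _ + _]addnA nth_encoding nth_cat size_endpoints.
rewrite ltnNge leq_addr addKn nth_cat size_endpoints.
by rewrite ltnNge leq_addr addKn.
Qed.

Lemma encoding_bound a : 4 <= a < 4 + 2 * size gs -> E a < n.
Proof.
move=> /andP[a4 aM]; have -> : a = 4 + (a - 4) by lia.
rewrite encoding_gs; last by lia.
have /(all_nthP 0) lt_n : all (ltn^~ n) (endpoints gs).
  by elim: gs => //= e s ->; rewrite !ltn_ord.
by apply: lt_n; rewrite size_endpoints; lia.
Qed.

Lemma joinedP v w : joined (size gs) E v w <->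
  exists2 e, e \in gs & (v = e.1 /\ w = e.2) \/ (v = e.2 /\ w = e.1).
Proof.
have nthE e0 j : j < size gs ->
    E (4 + 2 * j) = (nth e0 gs j).1 /\ E (5 + 2 * j) = (nth e0 gs j).2.
  move=> jm; have -> : 5 + 2 * j = 4 + (2 * j).+1 by lia.
  by rewrite !encoding_gs; [exact: nth_endpoints | lia | lia].
split.
  case=> a [j jm H] <-.
  have e0 : 'I_n * 'I_n by case: gs jm => // e0 s.
  have [E1 E2] := nthE e0 j jm; exists (nth e0 gs j); first exact: mem_nth.
  by case: H => -[-> ->]; rewrite ?E1 ?E2; auto.
case=> e egs H; have jm : index e gs < size gs by rewrite index_mem.
have [] := nthE e _ jm; rewrite nth_index // => E1 E2.
case: H => -[-> ->].
  by exists (5 + 2 * index e gs) => //; exists (index e gs) => //; right.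
by exists (4 + 2 * index e gs) => //; exists (index e gs) => //; left.
Qed.

End Encoding.

Theorem theorem6 : edge_tj_solvable_in_linear_time is_tree.
Proof.
(* With m the number of edges, 60 covers both the time, [34 * n + 50 * m + 54], and the words up to
   [4 * D], where [D] is at most [6 * m + n + 5] because both trees are subsets of the edges. *)
exists solver, 60 => n G Es Et gs ss ts VG sG fs ft lg ls lt bound.
have sizeg := edge_list_size lg; have sizes := edge_list_size ls.
have sizet := edge_list_size lt.
have sgs : size ss <= size gs by rewrite sizes sizeg subset_leq_card ?(proj1 fs).
have tgs : size ts <= size gs by rewrite sizet sizeg subset_leq_card ?(proj1 ft).
have s0 : 0 < size ss by rewrite sizes card_gt0 (feasible_neq0 fs).
have t0 : 0 < size ts by rewrite sizet card_gt0 (feasible_neq0 ft).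
have e0 : 'I_n * 'I_n by case: ss s0 {ls sizes sgs} => // e.
have boundE : bound = 60 * (n + size gs).+1 by rewrite sizeg.
clearbody bound.
set x := (nth e0 ss 0).1; set y := (nth e0 ts 0).1.
have xs : x \in cover Es by apply: edge_list_head ls s0.
have yt : y \in cover Et by apply: edge_list_head lt t0.
have spec := tree_tj_reconfigurable sG fs ft xs yt.
pose yes_instance := size ss = size ts /\ (size ss = 1 \/ linked (edges G) x y).
suff [t [s [run tb out]]] :
    runs bound solver (initial_state (encoding gs ss ts)) bound
      (fun s => (yes_instance -> output s = 1) /\ (~ yes_instance -> output s = 0)).
  exists t, s; rewrite -sizes -sizet in spec; case: out => yes no; split=> //.
    by move/spec.
  by move=> nr; apply: no => /spec.
set E := nth 0 (encoding gs ss ts).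
(* With truncated subtraction, the sum of both differences vanishes exactly when the sizes agree; as
   [ss] is nonempty, [size ss - 1] vanishes exactly for a single edge. *)
pose R s := [/\ ready n (size gs) E s, regs s 13 = size ss, regs s 14 = size ts,
  regs s 7 = size ss - 1 & regs s 8 = (size ts - size ss) + (size ss - size ts)].
apply: (@runs_weaken _ _ _ (12 + (34 * n + 50 * size gs + 40).+2)) (_ : _ <= _) (fun s h => h); last by lia.
apply: (runs_seq (R := R)).
  apply: wp_runs => /=; do 5 (split; first by lia).
  split=> //=; split=> //=; by [].
move=> s [rd s13 s14 s7 s8]; apply: runs_if; rewrite ?s8.
  move=> ne; exists 1, s; split=> //; first exact: exec_skip.
  split; first by case; lia.
  by move=> _; rewrite /output (ready0 rd).
move=> eqk; have {}eqk : size ss = size ts by lia.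
apply: runs_if; rewrite ?s7; last first.
  move=> s1; have {}s1 : size ss = 1 by lia.
  apply: runs_weaken (wp_runs (Q := fun s => output s = 1) _) _ _ => //=.
  - by split=> //; lia.
  - by lia.
  - by move=> s' ->; split=> // -[]; split=> //; left.
move=> s1; have {}s1 : size ss <> 1 by lia.
pose D := 4 + 2 * size gs + 2 * size ss + 2 * size ts + n + 1.
(* The machine sees vertices as numbers; [P] is reachability from [x] read on numbers, and it bounds
   the visited set from above. *)
pose P (v : nat) := exists2 z : 'I_n, v = z & linked (edges G) x z.
have Ex : E (4 + 2 * size gs) = x.
  have := encoding_ss gs ts (ss := ss) (a := 0); rewrite addn0 /E => ->; last by lia.
  by have [] := nth_endpoints e0 s0.
have Ey : E (4 + 2 * size gs + 2 * size ss) = y.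
  have := encoding_ts gs ss ts 0; rewrite addn0 /E => ->.
  by have [] := nth_endpoints e0 t0.
have step (a b : 'I_n) : [set a; b] \in edges G <-> joined (size gs) E a b.
  split=> [/(edge_listP _ _ lg)|/joinedP] [e eg H].
    by apply/joinedP; exists e => //; case: H => ->; auto.
  apply/(edge_listP _ _ lg); exists e => //; case: e H {eg} => c d /= [] [] /val_inj <- /val_inj <-; auto.
apply: runs_weaken (search_runs (P := P) (D := D) (W := bound) _ _ _ _ _ _ _ _ _
  rd s13 s14 _ (esym Ex) (esym Ey)) (leqnn _) _ => //.
- by rewrite /D; lia.
- by rewrite /D; lia.
- by rewrite /D; lia.
- exact: encoding_bound.
- by move=> a aD; apply: encoding_large; rewrite /D in aD; lia.
- by exists x => //; apply: linked_refl.
- move=> v w [z -> xz] /joinedP[e eg H].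
  have [u -> zu] : exists2 u : 'I_n, w = u & [set z; u] \in edges G.
    case: H => -[/val_inj zE ->]; [exists e.2 | exists e.1] => //;
    apply/(edge_listP _ _ lg); exists e => //; rewrite zE; case: (e); auto.
  by exists u => //; apply: linked_trans xz (linked1 zu).
move=> s' [vis [visx visP viscl out]].
have visE : vis y <-> linked (edges G) x y.
  split=> [/(visP _ (ltn_ord y))[z /val_inj -> //]|/connectP[p pp ->]].
  (* Conversely, closure under edges carries the mark from [x] along the path to [y]. *)
  elim: p (x) visx pp => //= b p IH a va /andP[ab pp].
  by apply: IH pp; apply: viscl va _ => //; apply/step.
rewrite out; split.
  by case=> _ [/s1 //|/visE ->].
move=> no; case vy: (vis y) => //; case: no; split=> //; right; exact/visE.
Qed.
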